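(* Let $\mathcal{M}_1,\mathcal{M}_2,\mathcal{M}_3$ be IMDPs. If $\mathcal{M}_1\sim_c\mathcal{M}_2$, then $\mathcal{M}_1\,|||\,\mathcal{M}_3\sim_c\mathcal{M}_2\,|||\,\mathcal{M}_3$.
   Context: IMDPs: an IMDP is $(S,\bar s,\mathcal{A},\mathtt{AP},L,I)$ with finite state set $S$, initial state $\bar s$, finite actions $\mathcal{A}$, finite atomic propositions $\mathtt{AP}$, labelling $L\colon S\to2^{\mathtt{AP}}$, and $I\colon S\times\mathcal{A}\times S\to\{\text{closed subintervals of }[0,1]\}$, each state having some $a,s'$ with $I(s,a,s')\ne[0,0]$. $\mathcal{A}(s)=\{a:\exists s'.\,I(s,a,s')\ne[0,0]\}$; for $a\in\mathcal{A}(s)$, $\mathcal{U}(s,a)=\{\mu\in\mathrm{Disc}(S):\mu(s')\in I(s,a,s')\ \forall s'\}$ (nonempty); $s\to\mu$ iff $\mu\in\mathrm{conv}(\bigcup_{a\in\mathcal{A}(s)}\mathcal{U}(s,a))$. For an equivalence relation $R$, $\mu_1\,\mathcal{L}(R)\,\mu_2$ iff $\mu_1(C)=\mu_2(C)$ for every class $C$. An IMDP probabilistic bisimulation is an equivalence relation $R$ such that for each $(s,t)\in R$, $L(s)=L(t)$ and every $s\to\mu_s$ is matched by some $t\to\mu_t$ with $\mu_s\,\mathcal{L}(R)\,\mu_t$; $\mathcal{M}_1\sim_c\mathcal{M}_2$ iff such $R$ exists on the disjoint union relating the initial states. Interleaved composition: $\mathcal{M}_l\,|||\,\mathcal{M}_r$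 is the IMDP with states $S_l\times S_r$, initial state $(\bar s_l,\bar s_r)$, actions $(\mathcal{A}_l\times\{l\})\cup(\mathcal{A}_r\times\{r\})$, propositions $\mathtt{AP}_l\cup\mathtt{AP}_r$, labelling $L(s_l,s_r)=L_l(s_l)\cup L_r(s_r)$, and $I((s_l,s_r),(a,i),(t_l,t_r))$ equal to $I_l(s_l,a,t_l)$ if $i=l$ and $t_r=s_r$, to $I_r(s_r,a,t_r)$ if $i=r$ and $t_l=s_l$, and to $[0,0]$ otherwise. *)

(* Defs.v *)
From HB Require Import structures.
From mathcomp Require Import all_boot all_order all_algebra finmap.
From mathcomp Require Import boolp classical_sets reals.

Set Implicit Arguments.
Unset Strict Implicit.
Unset Printing Implicit Defensive.
Import Order.TTheory GRing.Theory Num.Theory.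
Local Open Scope classical_set_scope.
Local Open Scope ring_scope.

(* Nonempty closed subintervals of [0,1], given by their endpoints. *)
Record itv01 (R : realType) := Itv01 {
  itv01_val :> R * R;
  itv01P : [&& 0 <= itv01_val.1, itv01_val.1 <= itv01_val.2 & itv01_val.2 <= 1]
}.
HB.instance Definition _ (R : realType) := [isSub for @itv01_val R].
HB.instance Definition _ (R : realType) := [Choice of itv01 R by <:].

Definition itv01_interval (R : realType) (J : itv01 R) : interval R :=
  `[(J : R * R).1, (J : R * R).2].

Fact itv00_subproof (R : realType) :
  let J : R * R := (0, 0) in [&& 0 <= J.1, J.1 <= J.2 & J.2 <= 1].
Proof. by rewrite /= !lexx ler01. Qed.

Definition itv00 (R : realType) : itv01 R := @Itv01 R (0, 0) (itv00_subproof R).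

Record disc (R : realType) (S : finType) := Disc {
  disc_val :> {ffun S -> R};
  discP : [forall s, 0 <= disc_val s] && (\sum_s disc_val s == 1)
}.
HB.instance Definition _ (R : realType) (S : finType) :=
  [isSub for @disc_val R S].
HB.instance Definition _ (R : realType) (S : finType) :=
  [Choice of disc R S by <:].

Definition conv_hull (R : realType) (S : finType) (X : set (disc R S)) :
    set (disc R S) :=
  [set mu | exists (n : nat) (w : 'I_n -> R) (nu : 'I_n -> disc R S),
    [/\ forall i, 0 <= w i,
        \sum_(i < n) w i = 1,
        forall i, X (nu i)
      & forall s, mu s = \sum_(i < n) w i * nu i s]].

Definition enabled (R : realType) (S A : finType) (I : S -> A -> S -> itv01 R)
    (s : S) (a : A) : bool :=
  [exists s', I s a s' != itv00 R].

Definition feasible (R : realType) (S A : finType) (I : S -> A -> S -> itv01 R)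
    (s : S) (a : A) : set (disc R S) :=
  [set mu | forall s', mu s' \in itv01_interval (I s a s')].

(* Propositions of all IMDPs are drawn from a common universe P, so that the
   proposition sets of different IMDPs may overlap arbitrarily. *)
Record imdp (R : realType) (P : choiceType) := Imdp {
  state : finType;
  init : state;
  action : finType;
  AP : {fset P};
  label : state -> {fset P};
  trans : state -> action -> state -> itv01 R;
  label_sub : forall s, (label s `<=` AP)%fset;
  exists_enabled : forall s, exists a, enabled trans s a;
  feasible_nonempty : forall s a, enabled trans s a -> feasible trans s a !=set0
}.

Definition step (R : realType) (P : choiceType) (M : imdp R P)
    (s : state M) : set (disc R (state M)) :=
  conv_hull (\bigcup_(a in [set a | enabled (@trans R P M) s a])
               feasible (@trans R P M) s a).

Definition lift_rel (R : realType) (S : finType) (r : rel S)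
    (mu1 mu2 : disc R S) : Prop :=
  forall C : {set S}, C \in equivalence_partition r [set: S] ->
    \sum_(s in C) mu1 s = \sum_(s in C) mu2 s.

Definition bisimulation (R : realType) (P : choiceType) (M : imdp R P)
    (r : rel (state M)) : Prop :=
  equivalence_rel r /\
  forall s t, r s t ->
    label s = label t /\
    forall mu_s, step s mu_s -> exists2 mu_t, step t mu_t & lift_rel r mu_s mu_t.

Section Embedding.
Variables (R : realType) (S S' : finType) (f : S -> S').

Fact disc_map_subproof (mu : disc R S) :
  let nu := [ffun t => \sum_(s | f s == t) mu s] in
  [forall t, 0 <= nu t] && (\sum_t nu t == 1).
Proof.
case: mu => mu /= /andP[/forallP mu0 /eqP mu1]; apply/andP; split.
  by apply/forallP => t; rewrite ffunE; apply: sumr_ge0.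
apply/eqP; rewrite -[RHS]mu1 [RHS](partition_big f xpredT) //=.
by apply: eq_bigr => t _; rewrite ffunE.
Qed.

Definition disc_map (mu : disc R S) : disc R S' := Disc (disc_map_subproof mu).

Variables (A A' : finType).
Variables (I : S -> A -> S -> itv01 R) (I' : S' -> A' -> S' -> itv01 R).
Variables (s : S) (a : A) (s' : S') (a' : A').
Hypothesis f_inj : injective f.
Hypothesis I'f : forall t, I' s' a' (f t) = I s a t.
Hypothesis I'0 : forall t', t' \notin codom f -> I' s' a' t' = itv00 R.

Lemma enabled_embed : enabled I' s' a' = enabled I s a.
Proof.
apply/existsP/existsP => -[t It]; last by exists (f t); rewrite I'f.
have [/codomP[u tu]|/I'0 I0] := boolP (t \in codom f).
  by exists u; rewrite -I'f -tu.
by rewrite I0 eqxx in It.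
Qed.

Lemma feasible_embed mu : feasible I s a mu -> feasible I' s' a' (disc_map mu).
Proof.
move=> fmu t' /=; rewrite ffunE.
have [/codomP[t ->]|tf] := boolP (t' \in codom f).
  by rewrite (big_pred1 t) ?I'f => [|u]; [exact: fmu | rewrite (inj_eq f_inj)].
rewrite I'0// big_pred0 => [|u]; first by rewrite /itv01_interval in_itv /= lexx.
by apply: contraNF tf => /eqP <-; exact: codom_f.
Qed.

End Embedding.

Section DisjointUnion.
Variables (R : realType) (P : choiceType) (M1 M2 : imdp R P).

Definition union_label (s : state M1 + state M2) : {fset P} :=
  match s with inl s1 => label s1 | inr s2 => label s2 end.

Definition union_trans (s : state M1 + state M2) (a : action M1 + action M2)
    (t : state M1 + state M2) : itv01 R :=
  match s, a, t with
  | inl s1, inl a1, inl t1 => trans s1 a1 t1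
  | inr s2, inr a2, inr t2 => trans s2 a2 t2
  | _, _, _ => itv00 R
  end.

Fact union_label_sub s : (union_label s `<=` AP M1 `|` AP M2)%fset.
Proof.
case: s => s /=; apply: fsubset_trans (label_sub s) _.
  exact: fsubsetUl.
exact: fsubsetUr.
Qed.

Fact inlI : injective (@inl (state M1) (state M2)). Proof. by move=> x y []. Qed.
Fact inrI : injective (@inr (state M1) (state M2)). Proof. by move=> x y []. Qed.

Fact union_inl0 s a t : t \notin codom (@inl (state M1) (state M2)) ->
  union_trans (inl s) (inl a) t = itv00 R.
Proof. by case: t => // t; rewrite codom_f. Qed.

Fact union_inr0 s a t : t \notin codom (@inr (state M1) (state M2)) ->
  union_trans (inr s) (inr a) t = itv00 R.
Proof. by case: t => // t; rewrite codom_f. Qed.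

Fact union_inl s a t : union_trans (inl s) (inl a) (inl t) = trans s a t.
Proof. by []. Qed.
Fact union_inr s a t : union_trans (inr s) (inr a) (inr t) = trans s a t.
Proof. by []. Qed.

Fact union_exists_enabled s : exists a, enabled union_trans s a.
Proof.
case: s => s; have [a ea] := exists_enabled s.
  by exists (inl a); rewrite (enabled_embed (union_inl s a) (@union_inl0 s a)).
by exists (inr a); rewrite (enabled_embed (union_inr s a) (@union_inr0 s a)).
Qed.

Fact union_feasible_nonempty s a :
  enabled union_trans s a -> feasible union_trans s a !=set0.
Proof.
case: s a => s [] a; try by case/existsP => -[] t; rewrite eqxx.
  rewrite (enabled_embed (union_inl s a) (@union_inl0 s a)).
  move=> /feasible_nonempty[mu fmu]; eexists.
  exact: (feasible_embed inlI (union_inl s a) (@union_inl0 s a) fmu).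
rewrite (enabled_embed (union_inr s a) (@union_inr0 s a)).
move=> /feasible_nonempty[mu fmu]; eexists.
exact: (feasible_embed inrI (union_inr s a) (@union_inr0 s a) fmu).
Qed.

(* Transitions between the two components, and actions of the other component,
   carry the interval [0,0]. The choice of the initial state is irrelevant:
   bisimulations ignore it. *)
Definition disjoint_union : imdp R P :=
  @Imdp R P (state M1 + state M2)%type (inl (init M1))
    (action M1 + action M2)%type (AP M1 `|` AP M2)%fset union_label union_trans
    union_label_sub union_exists_enabled union_feasible_nonempty.

Definition bisimilar : Prop :=
  exists r : rel (state disjoint_union),
    bisimulation r /\ r (inl (init M1)) (inr (init M2)).

End DisjointUnion.

Section InterleavedComposition.
Variables (R : realType) (P : choiceType) (Ml Mr : imdp R P).

Definition interleave_label (s : state Ml * state Mr) : {fset P} :=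
  (label s.1 `|` label s.2)%fset.

Definition interleave_trans (s : state Ml * state Mr)
    (a : action Ml + action Mr) (t : state Ml * state Mr) : itv01 R :=
  match a with
  | inl al => if t.2 == s.2 then trans s.1 al t.1 else itv00 R
  | inr ar => if t.1 == s.1 then trans s.2 ar t.2 else itv00 R
  end.

Fact interleave_label_sub s : (interleave_label s `<=` AP Ml `|` AP Mr)%fset.
Proof. by apply: fsetUSS; exact: label_sub. Qed.

Fact pairlI (u : state Mr) : injective (fun t : state Ml => (t, u)).
Proof. by move=> x y []. Qed.
Fact pairrI (u : state Ml) : injective (fun t : state Mr => (u, t)).
Proof. by move=> x y []. Qed.

Fact interleave_l s a t : interleave_trans s (inl a) (t, s.2) = trans s.1 a t.
Proof. by rewrite /= eqxx. Qed.
Fact interleave_r s a t : interleave_trans s (inr a) (s.1, t) = trans s.2 a t.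
Proof. by rewrite /= eqxx. Qed.

Fact interleave_l0 s a t : t \notin codom (fun u : state Ml => (u, s.2)) ->
  interleave_trans s (inl a) t = itv00 R.
Proof.
by case: t => u v /=; case: eqP => // ->; rewrite (codom_f (fun u => (u, s.2))).
Qed.

Fact interleave_r0 s a t : t \notin codom (fun u : state Mr => (s.1, u)) ->
  interleave_trans s (inr a) t = itv00 R.
Proof.
by case: t => u v /=; case: eqP => // ->; rewrite (codom_f (fun u => (s.1, u))).
Qed.

Fact interleave_exists_enabled s : exists a, enabled interleave_trans s a.
Proof.
have [a ea] := exists_enabled s.1; exists (inl a).
by rewrite (enabled_embed (interleave_l s a) (@interleave_l0 s a)).
Qed.

Fact interleave_feasible_nonempty s a :
  enabled interleave_trans s a -> feasible interleave_trans s a !=set0.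
Proof.
case: a => a.
  rewrite (enabled_embed (interleave_l s a) (@interleave_l0 s a)).
  move=> /feasible_nonempty[mu fmu]; eexists.
  exact: (feasible_embed (@pairlI _) (interleave_l s a) (@interleave_l0 s a) fmu).
rewrite (enabled_embed (interleave_r s a) (@interleave_r0 s a)).
move=> /feasible_nonempty[mu fmu]; eexists.
exact: (feasible_embed (@pairrI _) (interleave_r s a) (@interleave_r0 s a) fmu).
Qed.

Definition interleave : imdp R P :=
  @Imdp R P (state Ml * state Mr)%type (init Ml, init Mr)
    (action Ml + action Mr)%type (AP Ml `|` AP Mr)%fset interleave_label
    interleave_trans interleave_label_sub interleave_exists_enabled
    interleave_feasible_nonempty.

End InterleavedComposition.

(* Main.v *)
(* If [r] is a bisimulation on the disjoint union of [M1] and [M2], relate two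
   states of the disjoint union of the compositions when their first components
   are related by [r] and their [M3]-components coincide. A feasible
   distribution at such a state moves only one component, hence is the image of
   a feasible distribution of that component. By [r] (left moves) or by copying
   (right moves) it is matched by a convex combination of feasible
   distributions, and matching extends to convex combinations by linearity. *)
Require Import Defs.
From mathcomp Require Import all_boot all_order all_algebra finmap.
From mathcomp Require Import boolp classical_sets reals.

Set Implicit Arguments.
Unset Strict Implicit.
Unset Printing Implicit Defensive.
Import Order.TTheory GRing.Theory Num.Theory.
Local Open Scope classical_set_scope.
Local Open Scope ring_scope.

(** * Convex combinations of distributions and the lifting of relations *)

Section Distributions.
Variables (R : realType) (S : finType).
Implicit Types (mu nu : disc R S) (X Y : set (disc R S)) (r : rel S).

Lemma disc_ge0 mu s : 0 <= mu s.
Proof. by case: mu => mu /= /andP[/forallP]. Qed.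

Lemma disc_sum1 mu : \sum_s mu s = 1.
Proof. by case: mu => mu /= /andP[_ /eqP]. Qed.

Lemma disc_eq mu nu : (forall s, mu s = nu s) -> mu = nu.
Proof. by move=> e; apply: val_inj; apply/ffunP. Qed.

Lemma disc_ex (g : S -> R) : (forall s, 0 <= g s) -> \sum_s g s = 1 ->
  exists mu, forall s, mu s = g s.
Proof.
move=> g0 g1.
have P : [forall s, 0 <= [ffun s => g s] s] && (\sum_s [ffun s => g s] s == 1).
  apply/andP; split; first by apply/forallP => s; rewrite ffunE.
  by rewrite -g1; apply/eqP; apply: eq_bigr => s _; rewrite ffunE.
by exists (Disc P) => s /=; rewrite ffunE.
Qed.

Lemma disc_comb_ex (I : finType) (w : I -> R) (nu : I -> disc R S) :
  (forall i, 0 <= w i) -> \sum_i w i = 1 ->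
  exists mu, forall s, mu s = \sum_i w i * nu i s.
Proof.
move=> w0 w1; apply: disc_ex => [s|].
  by apply: sumr_ge0 => i _; rewrite mulr_ge0 ?disc_ge0.
rewrite exchange_big -[RHS]w1; apply: eq_bigr => i _ /=.
by rewrite -mulr_sumr disc_sum1 mulr1.
Qed.

(** Enumerating [I] turns any finite family into one over ordinals, as [conv_hull] demands; this
    serves below for [unit] and for a type of dependent pairs. *)
Lemma conv_hull_finType X (I : finType) (w : I -> R) (nu : I -> disc R S) mu :
  (forall i, 0 <= w i) -> \sum_i w i = 1 -> (forall i, X (nu i)) ->
  (forall s, mu s = \sum_i w i * nu i s) -> conv_hull X mu.
Proof.
move=> w0 w1 Xnu e; exists #|I|, (w \o enum_val), (nu \o enum_val).
have reidx (F : I -> R) : \sum_i F i = \sum_(k < #|I|) F (enum_val k).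
  by rewrite (reindex (@enum_val _ I)) //; apply: onW_bij; exact: enum_val_bij.
split=> //= [|s]; first by rewrite -w1 reidx.
by rewrite e reidx.
Qed.

Lemma conv_hull_sub X : X `<=` conv_hull X.
Proof.
move=> mu Xmu; apply: (@conv_hull_finType X unit (fun=> 1) (fun=> mu)) => //.
  by rewrite big_const card_unit /= addr0.
by move=> s; rewrite big_const card_unit /= addr0 mul1r.
Qed.

(** A nested combination flattens to one indexed by the pairs [(i, j)], with the products of outer
    and inner weights. *)
Lemma conv_hull_convex X n (w : 'I_n -> R) (nu : 'I_n -> disc R S) mu :
  (forall i, 0 <= w i) -> \sum_i w i = 1 -> (forall i, conv_hull X (nu i)) ->
  (forall s, mu s = \sum_i w i * nu i s) -> conv_hull X mu.
Proof.
move=> w0 w1 Xnu e.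
(* The number of inner points depends on [i], so size, weights and points are packed together and
   chosen at once. *)
have /choice[c cP] i : exists c : {m & ('I_m -> R) * ('I_m -> disc R S)}%type,
    [/\ forall j, 0 <= (tagged c).1 j, \sum_j (tagged c).1 j = 1,
        forall j, X ((tagged c).2 j)
      & forall s, nu i s = \sum_j (tagged c).1 j * (tagged c).2 j s].
  by have [m [v [xi h]]] := Xnu i; exists (existT _ m (v, xi)).
pose v i := (tagged (c i)).1; pose xi i := (tagged (c i)).2.
have sigE (F : forall i : 'I_n, 'I_(tag (c i)) -> R) :
    \sum_(p : {i : 'I_n & 'I_(tag (c i))}) F (tag p) (tagged p) =
    \sum_i \sum_j F i j.
  by rewrite sig_big_dep.
apply: (@conv_hull_finType X {i : 'I_n & 'I_(tag (c i))}
  (fun p => w (tag p) * v (tag p) (tagged p))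
  (fun p => xi (tag p) (tagged p))) => [p|||s].
- by rewrite mulr_ge0//; have [+ _ _ _] := cP (tag p); apply.
- rewrite -w1 (sigE (fun i j => w i * v i j)).
  apply: eq_bigr => i _; rewrite -mulr_sumr.
  by have [_ -> _ _] := cP i; rewrite mulr1.
- by move=> p; have [_ _ + _] := cP (tag p); apply.
- rewrite e (sigE (fun i j => w i * v i j * xi i j s)).
  apply: eq_bigr => i _; have [_ _ _ ->] := cP i.
  by rewrite mulr_sumr; apply: eq_bigr => j _; rewrite mulrA.
Qed.

(** The matches of the points are combined with the same weights; this preserves the lifting because
    the mass of a class is linear in the distribution. *)
Lemma conv_hull_lift_rel r X Y :
  (forall nu, X nu -> exists2 nu', conv_hull Y nu' & lift_rel r nu nu') ->
  forall mu, conv_hull X mu ->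
    exists2 mu', conv_hull Y mu' & lift_rel r mu mu'.
Proof.
move=> XY mu [n [w [nu [w0 w1 Xnu e]]]].
have /choice[xi xiP] : forall i, exists nu',
    conv_hull Y nu' /\ lift_rel r (nu i) nu'.
  by move=> i; have [nu' ? ?] := XY _ (Xnu i); exists nu'.
have [mu' e'] := disc_comb_ex xi w0 w1; exists mu'.
  by apply: conv_hull_convex e' => // i; have [] := xiP i.
move=> C CP; under eq_bigr do rewrite e; under [RHS]eq_bigr do rewrite e'.
rewrite exchange_big [RHS]exchange_big; apply: eq_bigr => i _.
by rewrite -!mulr_sumr; have [_ ->] := xiP i.
Qed.

(** Every block of [equivalence_partition] has the form of all [y] with [r x y], so classes can be
    replaced by representatives. *)
Lemma lift_relP r mu nu : lift_rel r mu nu <->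
  forall x, \sum_(y | r x y) mu y = \sum_(y | r x y) nu y.
Proof.
have clE (g : S -> R) x :
    \sum_(y in [set y in [set: S]%SET | r x y]%SET) g y = \sum_(y | r x y) g y.
  by apply: eq_bigl => y; rewrite !inE.
split=> [h x|h C /imsetP[x _ ->]]; last by rewrite !clE.
by rewrite -!clE; apply: h; apply/imsetP; exists x.
Qed.

End Distributions.

(** * Images of distributions under maps of states *)

Section Images.
Variables (R : realType) (S S' : finType).
Implicit Types (f g : S -> S') (mu nu : disc R S).

Lemma sum_disc_map f mu (Q : pred S') :
  \sum_(t | Q t) disc_map f mu t = \sum_(s | Q (f s)) mu s.
Proof.
rewrite [RHS](partition_big f Q) //=; apply: eq_bigr => t Qt; rewrite ffunE.
by apply: eq_bigl => s; case: eqP => [->|]; rewrite ?andbF ?Qt.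
Qed.

Lemma disc_mapE f mu t : disc_map f mu t = \sum_(s | f s == t) mu s.
Proof. by rewrite /= ffunE. Qed.

Lemma conv_hull_disc_map f (X : set (disc R S)) (Y : set (disc R S')) mu :
  (forall nu, X nu -> Y (disc_map f nu)) ->
  conv_hull X mu -> conv_hull Y (disc_map f mu).
Proof.
move=> XY [n [w [nu [w0 w1 Xnu e]]]].
exists n, w, (fun i => disc_map f (nu i)); split=> // [i|t].
  exact: XY.
under eq_bigr do rewrite disc_mapE mulr_sumr.
by rewrite disc_mapE exchange_big /=; apply: eq_bigr => s _; rewrite e.
Qed.

(** The preimage under [f] of a class of [r'] is either empty or a class of [r]. *)
Lemma lift_rel_disc_map (r : rel S) (r' : rel S') f mu nu :
  equivalence_rel r' ->
  (forall x y, r' (f x) (f y) = r x y) ->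
  lift_rel r mu nu -> lift_rel r' (disc_map f mu) (disc_map f nu).
Proof.
move=> er' frr /lift_relP h; apply/lift_relP => z; rewrite !sum_disc_map.
have [[x zx]|zN] := pselect (exists x, r' z (f x)).
  have clE : (fun y => r' z (f y)) =1 r x.
    by move=> y; rewrite -frr; have [_ /(_ zx)] := er' z (f x) (f y).
  by rewrite !(eq_bigl _ _ clE).
by rewrite !big1 // => y zy; case: zN; exists y.
Qed.

(** A class of [r'] has the same preimage under [f] and under [g]. *)
Lemma lift_rel_disc_map_pointwise (r' : rel S') f g mu :
  equivalence_rel r' ->
  (forall x, r' (f x) (g x)) -> lift_rel r' (disc_map f mu) (disc_map g mu).
Proof.
move=> er' fg; apply/lift_relP => z; rewrite !sum_disc_map.
apply: eq_bigl => x; have [_ /(_ (fg x)) e] := er' (f x) (g x) z.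
have sym a b : r' a b = r' b a.
  apply/idP/idP => ab; last first.
    by have [aa /(_ ab) <-] := er' b a b.
  by have [aa /(_ ab) <-] := er' a b a.
by rewrite sym e sym.
Qed.

Variables (A A' : finType).
Variables (I : S -> A -> S -> itv01 R) (I' : S' -> A' -> S' -> itv01 R).

(** Converse of [feasible_embed]: the intervals [0,0] force [nu] to vanish off the image of [f], so
    [nu \o f] already has total mass 1. *)
Lemma feasible_embed_inv f s a s' a' (nu : disc R S') : injective f ->
  (forall t, I' s' a' (f t) = I s a t) ->
  (forall t', t' \notin codom f -> I' s' a' t' = itv00 R) ->
  feasible I' s' a' nu -> exists2 mu, feasible I s a mu & nu = disc_map f mu.
Proof.
move=> f_inj If I0 fnu.
have nu0 t' : t' \notin codom f -> nu t' = 0.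
  move=> /I0 e; have := fnu t'; rewrite e /itv01_interval in_itv /= => h.
  by apply/eqP; rewrite eq_le andbC.
have [|mu mue] := @disc_ex R S (nu \o f) (fun s => disc_ge0 nu (f s)).
  rewrite -(disc_sum1 nu) [RHS](bigID (mem (codom f))) /=.
  rewrite [X in _ = _ + X]big1 ?addr0; last exact: nu0.
  by rewrite -big_uniq ?big_image //; exact/injectiveP.
exists mu => [t|]; first by rewrite mue -If; exact: fnu.
apply: disc_eq => t; rewrite disc_mapE.
have [/codomP[x ->]|tf] := boolP (t \in codom f).
  by rewrite (big_pred1 x) ?mue // => y; rewrite (inj_eq f_inj).
rewrite nu0 // big_pred0 // => y.
by apply: contraNF tf => /eqP <-; exact: codom_f.
Qed.

End Images.

(** * The bisimulation between the compositions *)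

Section Congruence.
Variables (R : realType) (P : choiceType) (M1 M2 M3 : imdp R P).
Local Notation U := (disjoint_union M1 M2).
Local Notation W := (disjoint_union (interleave M1 M3) (interleave M2 M3)).

(** Together with the two projections below, this identifies the states of [W] with pairs of a state
    of [U] and a state of [M3], so that both summands are mostly treated at once. *)
Definition pair_state (p : state U) (u : state M3) : state W :=
  match p with inl s => inl (s, u) | inr s => inr (s, u) end.

Definition left_state (x : state W) : state U :=
  match x with inl y => inl y.1 | inr y => inr y.1 end.

Definition right_state (x : state W) : state M3 :=
  match x with inl y => y.2 | inr y => y.2 end.

Definition left_action (a : action U) : action W :=
  match a with inl a1 => inl (inl a1) | inr a2 => inr (inl a2) end.

(** Each action of [M3] occurs once in either summand of [W]; [p] selects the copy that can move. *)
Definition right_action (p : state U) (a : action M3) : action W :=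
  match p with inl _ => inl (inr a) | inr _ => inr (inr a) end.

Lemma pair_stateK1 p u : left_state (pair_state p u) = p.
Proof. by case: p. Qed.

Lemma pair_stateK2 p u : right_state (pair_state p u) = u.
Proof. by case: p. Qed.

Lemma pair_stateK x : pair_state (left_state x) (right_state x) = x.
Proof. by case: x => -[]. Qed.

Lemma pair_statelI u : injective (pair_state^~ u).
Proof. exact: can_inj (pair_stateK1^~ u). Qed.

Lemma pair_staterI p : injective (pair_state p).
Proof. exact: can_inj (pair_stateK2 p). Qed.

Lemma trans_left p u a q :
  @trans _ _ W (pair_state p u) (left_action a) (pair_state q u) =
  @trans _ _ U p a q.
Proof. by case: p a q => [s|s] [a|a] [t|t] //=; rewrite eqxx. Qed.

Lemma trans_left0 p u a x : x \notin codom (pair_state^~ u) ->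
  @trans _ _ W (pair_state p u) (left_action a) x = itv00 R.
Proof.
rewrite -{1}(pair_stateK x); case: (eqVneq (right_state x) u) => [->|].
  by rewrite (codom_f (pair_state^~ u)).
by case: p a x => [s|s] [a|a] [[t v]|[t v]] //= /negPf ->.
Qed.

Lemma trans_right p u a v :
  @trans _ _ W (pair_state p u) (right_action p a) (pair_state p v) =
  trans u a v.
Proof. by case: p => s /=; rewrite eqxx. Qed.

Lemma trans_right0 p u a x : x \notin codom (pair_state p) ->
  @trans _ _ W (pair_state p u) (right_action p a) x = itv00 R.
Proof.
rewrite -{1}(pair_stateK x); case: (eqVneq (left_state x) p) => [->|].
  by rewrite codom_f.
case: p x => [s|s] [[t v]|[t v]] //= ne; case: eqP => // ts _;
  by rewrite ts eqxx in ne.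
Qed.

Lemma enabled_left p u a :
  enabled (@trans _ _ W) (pair_state p u) (left_action a) =
  enabled (@trans _ _ U) p a.
Proof. exact: (enabled_embed (trans_left p u a) (@trans_left0 p u a)). Qed.

Lemma enabled_right p u a :
  enabled (@trans _ _ W) (pair_state p u) (right_action p a) =
  enabled (@trans _ _ M3) u a.
Proof. exact: (enabled_embed (trans_right p u a) (@trans_right0 p u a)). Qed.

(** The only actions of neither form are the copies of [M3]-actions in the summand opposite to [p],
    where all intervals are [0,0]. *)
Lemma enabled_leftVright p u b :
  enabled (@trans _ _ W) (pair_state p u) b ->
  (exists a, b = left_action a) \/ (exists a, b = right_action p a).
Proof.
case: b => [[a|a]|[a|a]]; first by left; exists (inl a).
- case: p => s /=; first by right; exists a.
  by case/existsP => -[] t /=; rewrite eqxx.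
- by left; exists (inr a).
- case: p => s /=; last by right; exists a.
  by case/existsP => -[] t /=; rewrite eqxx.
Qed.

Lemma step_left p u (mu : disc R (state U)) : step p mu ->
  step (pair_state p u) (disc_map (pair_state^~ u) mu).
Proof.
apply: conv_hull_disc_map => nu [a ea fnu]; exists (left_action a).
  by rewrite /= enabled_left.
exact: (feasible_embed (@pair_statelI u) (trans_left p u a)
  (@trans_left0 p u a) fnu).
Qed.

Variable r : rel (state U).

Definition pair_rel (x y : state W) : bool :=
  r (left_state x) (left_state y) && (right_state x == right_state y).

Lemma pair_rel_equiv : equivalence_rel r -> equivalence_rel pair_rel.
Proof.
move=> er x y z; rewrite /pair_rel.
have [rxx rxy] := er (left_state x) (left_state y) (left_state z).
by rewrite rxx eqxx; split=> // /andP[/rxy -> /eqP ->].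
Qed.

Lemma bisimulation_pair_rel :
  @bisimulation _ _ U r -> @bisimulation _ _ W pair_rel.
Proof.
move=> [er rbis]; have ep := pair_rel_equiv er; split=> // x y.
(* Both states take the form [pair_state _ u] with a common [u]. *)
rewrite -(pair_stateK x) -(pair_stateK y) /pair_rel !pair_stateK1 !pair_stateK2.
move: (left_state x) (left_state y) (right_state x) (right_state y).
move=> p q u _ /andP[pq /eqP <-]; have [lpq spq] := rbis _ _ pq.
split.
  have labelE p' : @label _ _ W (pair_state p' u) =
      (@label _ _ U p' `|` label u)%fset by case: p'.
  by rewrite !labelE lpq.
apply: conv_hull_lift_rel => nu [b eb fnu].
have [[a ab]|[a ab]] := enabled_leftVright eb; subst b.
  have [mu fmu ->] := feasible_embed_inv (@pair_statelI u) (trans_left p u a)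
    (@trans_left0 p u a) fnu.
  (* A single feasible [mu] is a trivial combination, hence a step of [U]; its match [mu'] may be a
     proper combination. *)
  have [|mu' smu' mumu'] := spq mu.
    by apply: conv_hull_sub; exists a; rewrite // /= -(enabled_left p u a).
  exists (disc_map (pair_state^~ u) mu'); first exact: step_left.
  apply: lift_rel_disc_map mumu' => // s t.
  by rewrite /pair_rel !pair_stateK1 !pair_stateK2 eqxx andbT.
have [mu fmu ->] := feasible_embed_inv (@pair_staterI p) (trans_right p u a)
  (@trans_right0 p u a) fnu.
(* The same move of [M3] from [u], now placed beside [q] and performed by the copy of [a] in the
   summand of [q]. *)
exists (disc_map (pair_state q) mu).
  apply: conv_hull_sub; exists (right_action q a).
    by rewrite /= enabled_right -(enabled_right p u a).
  exact: (feasible_embed (@pair_staterI q) (trans_right q u a)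
    (@trans_right0 q u a) fmu).
apply: lift_rel_disc_map_pointwise => // v.
by rewrite /pair_rel !pair_stateK1 !pair_stateK2 pq eqxx.
Qed.

End Congruence.

Theorem theorem3 (R : realType) (P : choiceType) (M1 M2 M3 : imdp R P) :
  bisimilar M1 M2 -> bisimilar (interleave M1 M3) (interleave M2 M3).
Proof.
move=> [r [rbis r12]]; exists (@pair_rel _ _ M1 M2 M3 r).
by split; [exact: bisimulation_pair_rel | rewrite /pair_rel /= r12 eqxx].
Qed.
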